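(* Let $H=(V,E)$ be a minimal strict implication hypergraph with vertices $V=\{p_1,\ldots,p_n\}$ and adjacency matrix $A$, and let $\nu,\epsilon>0$. If $H$ is configured, then for all $i\in\{1,\ldots,n\}$, \[ 0\le \sum_{j=1}^n A_{ij}A_{ji}<1. \]
   Context: A directed hypergraph $H=(V,E)$ has vertex set $V$ and hyperedges $e=(T,H)$ with $T,H\subseteq V$; $t(e)=T$ is the tail and $h(e)=H$ the head. An implication hypergraph is a directed hypergraph whose vertices are logical propositions and in which a hyperedge $(T,H)$ represents $\bigwedge_{P\in T}P\implies\bigwedge_{Q\in H}Q$. A vertex $u$ is a descendant of $v$ if it can be reached from $v$ by following hyperedges from tail to head. It is strict if for all $v,w\in V$, $(\{v\},\{w\})\in E$ implies $(\{w\},\{v\})\notin E$. It is minimal if (i) $(\{v\},\{v\})\notin E$ for all $v$; (ii) if $u$ is a descendant of $v$ but not an immediate neighbor of $v$, then $(\{v\},\{u\})\notin E$; (iii) if $(T,H)\in E$ then $(T',H)\notin E$ for every $T'\supsetneq T$. A leaf node is a vertex lying in the tail of no hyperedge; $L(H)$ denotes the set of leaf nodes. The adjacency matrix $A$ is the $n\times n$ matrix with $A_{ij}=\sum_{e\in E,\ p_i\in t(e)}\frac{1}{|t(e)|}\mathbf{1}_{p_j\in h(e)}$. The propositional information $\mathcal{I}_{\nu,\epsilon}(p_i)$ is defined implicitly by the system: $\mathcal{I}_{\nu,\epsilon}(p_i)=\sum_{j=1}^n A_{ij}(\mathcal{I}_{\nu,\epsilon}(p_j)+\epsilon)$ if $p_i\notin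 L(H)$, and $\mathcal{I}_{\nu,\epsilon}(p_i)=\nu$ if $p_i\in L(H)$. $H$ is called configured (for the given $\nu,\epsilon$) if this system has a solution with $\mathcal{I}_{\nu,\epsilon}(p_i)>0$ for all $i\in\{1,\ldots,n\}$. *)

(* Defs.v *)
From HB Require Import structures.
From mathcomp Require Import all_boot all_order all_algebra.

Set Implicit Arguments.
Unset Strict Implicit.
Unset Printing Implicit Defensive.

Import Order.TTheory GRing.Theory Num.Theory.
Local Open Scope ring_scope.

Notation hyperedge V := ({set V} * {set V})%type.

Definition tail (V : finType) (e : hyperedge V) : {set V} := e.1.
Definition head (V : finType) (e : hyperedge V) : {set V} := e.2.

Record dihypergraph (V : finType) : Type :=
  Dihypergraph { hyperedges : {set hyperedge V} }.

(* A vertex is identified with a proposition through its content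
   [ih_prop G v]; distinct vertices may have equivalent contents.  A hyperedge
   stands for the implication [hyperedge_implication G e]; being a hyperedge
   does not by itself assert that this implication holds. *)
Record implication_hypergraph (V : finType) : Type := ImplicationHypergraph {
  ih_hypergraph :> dihypergraph V;
  ih_prop : V -> Prop
}.

Definition hyperedge_implication (V : finType) (G : implication_hypergraph V)
    (e : hyperedge V) : Prop :=
  (forall P, P \in tail e -> ih_prop G P) ->
  (forall Q, Q \in head e -> ih_prop G Q).

Definition immediate_neighbor (V : finType) (G : dihypergraph V) : rel V :=
  fun v u => [exists e in hyperedges G, (v \in tail e) && (u \in head e)].

Definition descendant (V : finType) (G : dihypergraph V) : rel V :=
  fun v u => connect (immediate_neighbor G) v u.

Definition remove_hyperedge (V : finType) (G : dihypergraph V)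
    (e : hyperedge V) : dihypergraph V :=
  Dihypergraph (hyperedges G :\ e).

Definition strict (V : finType) (G : dihypergraph V) : Prop :=
  forall v w : V, ([set v], [set w]) \in hyperedges G ->
    ([set w], [set v]) \notin hyperedges G.

(* The second clause says that ({v}, {u}) is not a shortcut: u is not a
   descendant of v without being an immediate neighbor of v.  Both notions are
   evaluated in the hypergraph deprived of ({v}, {u}), since ({v}, {u}) itself
   would make u an immediate neighbor of v and the clause would be void.  For
   u = v, where [descendant] holds trivially, the clause follows from the
   first one. *)
Definition minimal (V : finType) (G : dihypergraph V) : Prop :=
  [/\ forall v : V, ([set v], [set v]) \notin hyperedges G,
      forall v u : V,
        let G' := remove_hyperedge G ([set v], [set u]) in
        descendant G' v u -> ~~ immediate_neighbor G' v u ->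
        ([set v], [set u]) \notin hyperedges G
    & forall T T' K : {set V}, (T, K) \in hyperedges G -> T \proper T' ->
        (T', K) \notin hyperedges G].

Definition leaves (V : finType) (G : dihypergraph V) : {set V} :=
  [set v | [forall e in hyperedges G, v \notin tail e]].

(* [p] enumerates the vertices. *)
Definition adjacency (R : realFieldType) (V : finType) (G : dihypergraph V)
    (n : nat) (p : 'I_n -> V) : 'M[R]_n :=
  \matrix_(i < n, j < n)
    \sum_(e in hyperedges G | p i \in tail e)
      #|tail e|%:R^-1 * (p j \in head e)%:R.

Definition propositional_information (R : realFieldType) (V : finType)
    (G : dihypergraph V) (n : nat) (p : 'I_n -> V) (nu eps : R)
    (I : V -> R) : Prop :=
  forall i : 'I_n,
    (p i \notin leaves G ->
       I (p i) = \sum_(j < n) adjacency R G p i j * (I (p j) + eps)) /\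
    (p i \in leaves G -> I (p i) = nu).

Definition configured (R : realFieldType) (V : finType) (G : dihypergraph V)
    (n : nat) (p : 'I_n -> V) (nu eps : R) : Prop :=
  exists I : V -> R,
    propositional_information G p nu eps I /\ forall i : 'I_n, 0 < I (p i).

(* Main.v *)
Require Import Defs.
From HB Require Import structures.
From mathcomp Require Import all_boot all_order all_algebra.

Set Implicit Arguments.
Unset Strict Implicit.
Unset Printing Implicit Defensive.

Import Order.TTheory GRing.Theory Num.Theory.
Local Open Scope ring_scope.

(** Every row of the system gives I_j >= A_ji (I_i + eps), trivially when j is a
    leaf since row j of A then vanishes.  Substituting this into row i gives
    I_i >= S (I_i + eps) with S = \sum_j A_ij A_ji, and I_i < I_i + eps forces
    S < 1. *)

Lemma adjacency_ge0 (R : realFieldType) (V : finType) (G : dihypergraph V)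
    (n : nat) (p : 'I_n -> V) (i j : 'I_n) : 0 <= adjacency R G p i j.
Proof. by rewrite mxE sumr_ge0 // => e _; rewrite mulr_ge0 ?invr_ge0 ?ler0n. Qed.

Lemma adjacency_leaf (R : realFieldType) (V : finType) (G : dihypergraph V)
    (n : nat) (p : 'I_n -> V) (i j : 'I_n) :
  p i \in leaves G -> adjacency R G p i j = 0.
Proof.
rewrite inE => /forall_inP leaf_i; rewrite mxE big_pred0 // => e.
by apply/negP => /andP[/leaf_i/negP].
Qed.

(** Relaxing the row equation to an inequality lets leaves and non-leaves be treated uniformly
    afterwards. *)
Lemma sum_adjacency_le_information (R : realFieldType) (V : finType)
    (G : dihypergraph V) (n : nat) (p : 'I_n -> V) (nu eps : R) (I : V -> R) :
  propositional_information G p nu eps I -> (forall i : 'I_n, 0 < I (p i)) ->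
  forall i : 'I_n, \sum_(j < n) adjacency R G p i j * (I (p j) + eps) <= I (p i).
Proof.
move=> infoI I_gt0 i; case: (boolP (p i \in leaves G)) => [leaf_i | nleaf_i].
  (* At a leaf the sum is zero, so positivity of [I] suffices. *)
  by rewrite big1 ?ltW // => j _; rewrite adjacency_leaf ?mul0r.
by rewrite -(infoI i).1.
Qed.

Theorem theorem1 (R : realFieldType) (V : finType)
    (G : implication_hypergraph V) (n : nat) (p : 'I_n -> V)
    (p_bij : bijective p)
    (G_minimal : minimal G) (G_strict : strict G)
    (nu eps : R) (nu_gt0 : 0 < nu) (eps_gt0 : 0 < eps)
    (G_configured : configured G p nu eps) :
  forall i : 'I_n,
    0 <= \sum_(j < n) adjacency R G p i j * adjacency R G p j i < 1.
Proof.
have [I [infoI I_gt0]] := G_configured => i.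
have rowI := sum_adjacency_le_information infoI I_gt0.
have Ieps_gt0 j : 0 < I (p j) + eps by rewrite addr_gt0.
rewrite sumr_ge0 => [|j _]; last by rewrite mulr_ge0 ?adjacency_ge0.
rewrite /= -(ltr_pM2r (Ieps_gt0 i)) mul1r.
apply: le_lt_trans (_ : I (p i) < _); last by rewrite ltrDl.
(* Compare with row [i] term by term: since [A_ij >= 0], it is enough that
   [A_ji (I_i + eps) <= I_j + eps]. *)
apply: le_trans (rowI i); rewrite mulr_suml ler_sum // => j _.
rewrite -mulrA ler_wpM2l ?adjacency_ge0 //.
apply: le_trans (_ : I (p j) <= _); last by rewrite lerDl ltW.
(* The left side is the term of index [i] in row [j], whose other terms are nonnegative. *)
apply: le_trans (rowI j); rewrite (bigD1 i) //= lerDl sumr_ge0 // => k _.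
by rewrite mulr_ge0 ?adjacency_ge0 ?ltW.
Qed.
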